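(* Let $u$ be a smooth axisymmetric Navier–Stokes solution with viscosity $\nu>0$, $\Gamma=ru^\theta$, $b=(u^r,u^z)$. On a region where $\Gamma$ is sign-definite (nonvanishing) and $r>0$, write $\phi=\log|\Gamma|$ and, for $p>0$ and $k\in\mathbb R$, set $$\rho_{p,k}=|\Gamma|^pr^{-k},\qquad c_p=b-p\nu\nabla\phi .$$ Then $$\partial_t\rho_{p,k}+\nabla\cdot(\rho_{p,k}c_p)=\rho_{p,k}\left[(k+1)q+p\nu\left((k-1)\frac{\phi_r}{r}-(p-1)|\nabla\phi|^2\right)\right],$$ where $q=-u^r/r$. The current action $$\iint\rho_{p,k}|c_p|^2\,dr\,dz\,dt$$ has physical scale weight $R^{2-k}$, independently of $p$. The compression term $(k+1)q$ disappears from the continuity equation only when $k=-1$, whereas the action is scale invariant only when $k=2$.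
   Context: $\nabla=(\partial_r,\partial_z)$ and $\nabla\cdot$ is the flat divergence in the meridional variables $(r,z)$. The circulation satisfies $\partial_t\Gamma+b\cdot\nabla\Gamma=\nu(\Gamma_{rr}-\frac1r\Gamma_r+\Gamma_{zz})$ and incompressibility is $\partial_r(ru^r)+\partial_z(ru^z)=0$. ''Physical scale weight $R^{w}$'' means: if $u(x,t)=R^{-1}\hat u(x/R,t/R^2)$ (Navier–Stokes scaling at length $R$), then the quantity computed for $u$ on a space-time region equals $R^{w}$ times the quantity computed for $\hat u$ on the correspondingly rescaled region; scale invariant means $w=0$. *)

(* Defs.v *)
From HB Require Import structures.
From mathcomp Require Import all_boot all_order all_algebra.
From mathcomp Require Import all_classical all_reals all_analysis.
Set Implicit Arguments.
Unset Strict Implicit.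
Unset Printing Implicit Defensive.
Import Order.TTheory GRing.Theory Num.Theory.
Import numFieldNormedType.Exports.
Local Open Scope classical_set_scope.
Local Open Scope ring_scope.

(* For U open and V finite-dimensional this is the usual class C^n on U; the   *)
(* directions v range over all of V, so no basis has to be fixed.              *)
Fixpoint class_C (R : realType) (V : normedModType R) (n : nat) (U : set V)
    (f : V -> R) : Prop :=
  if n is m.+1 then
    (forall a, U a -> differentiable f a) /\ (forall v, class_C m U ('D_v f))
  else forall a, U a -> {for a, continuous f}.

Definition smooth_on (R : realType) (V : normedModType R) (U : set V)
    (f : V -> R) : Prop := forall n, class_C n U f.

Section NavierStokes.
Variable R : realType.

(* Cartesian velocity components and pressure, as functions of (x, y, z, t),   *)
(* where (x, y, z, t) stands for (((x, y), z), t).                             *)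
Record flow := Flow {
  ux : R * R * R * R -> R;
  uy : R * R * R * R -> R;
  uz : R * R * R * R -> R;
  pres : R * R * R * R -> R }.

Definition Dx (f : R * R * R * R -> R) : R * R * R * R -> R :=
  'D_((1, 0, 0, 0) : R * R * R * R) f.
Definition Dy (f : R * R * R * R -> R) : R * R * R * R -> R :=
  'D_((0, 1, 0, 0) : R * R * R * R) f.
Definition Dz (f : R * R * R * R -> R) : R * R * R * R -> R :=
  'D_((0, 0, 1, 0) : R * R * R * R) f.
Definition Dt (f : R * R * R * R -> R) : R * R * R * R -> R :=
  'D_((0, 0, 0, 1) : R * R * R * R) f.

Definition laplacian (f : R * R * R * R -> R) (a : R * R * R * R) : R :=
  Dx (Dx f) a + Dy (Dy f) a + Dz (Dz f) a.

Definition advect (u : flow) (f : R * R * R * R -> R) (a : R * R * R * R) : R :=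
  ux u a * Dx f a + uy u a * Dy f a + uz u a * Dz f a.

Definition navier_stokes (nu : R) (U : set (R * R * R * R)) (u : flow) : Prop :=
  [/\ open U,
      [/\ smooth_on U (ux u), smooth_on U (uy u), smooth_on U (uz u)
        & smooth_on U (pres u)],
      (forall a, U a -> Dx (ux u) a + Dy (uy u) a + Dz (uz u) a = 0)
    & (forall a, U a ->
        [/\ Dt (ux u) a + advect u (ux u) a
              = - Dx (pres u) a + nu * laplacian (ux u) a,
            Dt (uy u) a + advect u (uy u) a
              = - Dy (pres u) a + nu * laplacian (uy u) a
          & Dt (uz u) a + advect u (uz u) a
              = - Dz (pres u) a + nu * laplacian (uz u) a])].

Definition rotz (th : R) (a : R * R * R * R) : R * R * R * R :=
  let: (x, y, z, t) := a in
  (cos th * x - sin th * y, sin th * x + cos th * y, z, t).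

(* Invariance under all rotations about the z-axis, i.e. the components of u   *)
(* in the frame (e_r, e_theta, e_z) and the pressure do not depend on theta.   *)
Definition axisymmetric (U : set (R * R * R * R)) (u : flow) : Prop :=
  forall th a, U a ->
    [/\ U (rotz th a),
        ux u (rotz th a) = cos th * ux u a - sin th * uy u a,
        uy u (rotz th a) = sin th * ux u a + cos th * uy u a,
        uz u (rotz th a) = uz u a
      & pres u (rotz th a) = pres u a].

Definition axisymmetric_NS (nu : R) (U : set (R * R * R * R)) (u : flow) :
  Prop := navier_stokes nu U u /\ axisymmetric U u.

(* Meridional variables: (r, z, t) stands for ((r, z), t).                     *)
Definition rcoord (m : R * R * R) : R := m.1.1.

(* The half-plane theta = 0, where e_r = e_x and e_theta = e_y.                *)
Definition lift0 (m : R * R * R) : R * R * R * R := (m.1.1, 0, m.1.2, m.2).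

Definition ur (u : flow) (m : R * R * R) : R := ux u (lift0 m).
Definition utheta (u : flow) (m : R * R * R) : R := uy u (lift0 m).
Definition uzm (u : flow) (m : R * R * R) : R := uz u (lift0 m).

Definition d_r (f : R * R * R -> R) : R * R * R -> R :=
  'D_((1, 0, 0) : R * R * R) f.
Definition d_z (f : R * R * R -> R) : R * R * R -> R :=
  'D_((0, 1, 0) : R * R * R) f.
Definition d_t (f : R * R * R -> R) : R * R * R -> R :=
  'D_((0, 0, 1) : R * R * R) f.

(* Meridional vector fields are given by their two components.                 *)
Definition grad (f : R * R * R -> R) (m : R * R * R) : R * R :=
  (d_r f m, d_z f m).
Definition flat_div (c : R * R * R -> R * R) (m : R * R * R) : R :=
  d_r (fun m' => (c m').1) m + d_z (fun m' => (c m').2) m.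
(* |v|^2 for the Euclidean norm; the library norm on R * R is the sup norm.    *)
Definition sqnorm (v : R * R) : R := v.1 ^+ 2 + v.2 ^+ 2.

Definition Gamma (u : flow) (m : R * R * R) : R := rcoord m * utheta u m.
Definition drift (u : flow) (m : R * R * R) : R * R := (ur u m, uzm u m).
Definition phi (u : flow) (m : R * R * R) : R := ln `|Gamma u m|.
Definition compression (u : flow) (m : R * R * R) : R := - ur u m / rcoord m.

Definition rho (p k : R) (u : flow) (m : R * R * R) : R :=
  `|Gamma u m| `^ p * rcoord m `^ (- k).
Definition current_velocity (nu p : R) (u : flow) (m : R * R * R) : R * R :=
  drift u m - (p * nu) *: grad (phi u) m.

(* A region of (r, z, t)-space in the domain of the flow, off the axis, on     *)
(* which the circulation does not vanish.                                      *)
Definition swirl_region (U : set (R * R * R * R)) (u : flow)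
    (D : set (R * R * R)) : Prop :=
  measurable D /\
  forall m, D m -> [/\ U (lift0 m), 0 < rcoord m & Gamma u m != 0].

(* The integrand is nonnegative, so the integral is defined in [0, +oo].       *)
Definition action (nu p k : R) (u : flow) (D : set (R * R * R)) : \bar R :=
  (\int[(@lebesgue_measure R \x @lebesgue_measure R) \x @lebesgue_measure R]_(m in D)
     (rho p k u m * sqnorm (current_velocity nu p u m))%:E)%E.

(* u(x, t) = L^-1 v(x / L, t / L^2); the pressure then scales like L^-2.       *)
Definition ns_rescale (L : R) (v : flow) : flow :=
  let s (a : R * R * R * R) : R * R * R * R :=
    let: (x, y, z, t) := a in (x / L, y / L, z / L, t / L ^+ 2) in
  Flow (fun a => L^-1 * ux v (s a)) (fun a => L^-1 * uy v (s a))
       (fun a => L^-1 * uz v (s a)) (fun a => L ^- 2 * pres v (s a)).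

(* The region whose rescaling by (r / L, z / L, t / L^2) is D.                 *)
Definition region_rescale (L : R) (D : set (R * R * R)) : set (R * R * R) :=
  [set m | D (m.1.1 / L, m.1.2 / L, m.2 / L ^+ 2)].

Definition has_scale_weight (nu : R) (Q : flow -> set (R * R * R) -> \bar R)
    (w : R) : Prop :=
  forall (L : R) (U : set (R * R * R * R)) (v : flow) (D : set (R * R * R)),
    0 < L -> axisymmetric_NS nu U v -> swirl_region U v D ->
    Q (ns_rescale L v) (region_rescale L D) = ((L `^ w)%:E * Q v D)%E.

Definition scale_invariant (nu : R) (Q : flow -> set (R * R * R) -> \bar R) :
  Prop := has_scale_weight nu Q 0.

End NavierStokes.

(* Main.v *)
(* On the half-plane theta = 0 the azimuthal derivatives of an axisymmetric
   field are algebraic in its components, so the Cartesian uy-equation becomes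
   the circulation equation and the continuity identity is the chain rule for
   rho = exp (p phi - k ln r), with nu laplacian(phi) cancelling.  Under
   rescaling Gamma is invariant, the velocity gains L^-1, r^-k gains L^-k and
   dr dz dt gains L^4, which gives the weight 2 - k.  Both "only if" claims are
   witnessed by the strained vortex u^r = - r / 2, u^theta = e^t r, u^z = z: it
   has nonzero compression, and its action over a box is finite and positive. *)
Require Import Defs.
From HB Require Import structures.
From mathcomp Require Import all_boot all_order all_algebra.
From mathcomp Require Import all_classical all_reals all_analysis.
From mathcomp Require Import measurable_realfun ring lra.
Import Order.TTheory GRing.Theory Num.Theory.
Import numFieldNormedType.Exports.
Local Open Scope classical_set_scope.
Local Open Scope ring_scope.

(* Unqualified, this name is taken by the permutation library. *)
Local Notation lift0 := Defs.lift0.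

(** * Directional derivatives *)

(** The domain [D] is only measurable, so no derivative can be taken inside it. The differential
    identity is proved at single points with r > 0 and nonzero circulation. These points form an
    open set, so a first-derivative formula holds nearby and can be differentiated again. For the
    converse claims, a witness with action 0 or +oo would be useless, since such a value satisfies
    every scale weight; hence the two-sided bounds on the action. A velocity linear in x, y, z has
    zero Laplacian, so the strained vortex solves the equations for every [nu]. Its circulation e^t
    r^2 vanishes only on the axis and its compression is 1/2 everywhere. *)

Lemma is_derive_affine {R : realType} {V W : normedModType R} (f : W -> R)
    (s : V -> W) (a v : V) (w : W) (df : R) :
  (forall h : R, s (h *: v + a) = h *: w + s a) ->
  is_derive (s a) w f df -> is_derive a v (f \o s) df.
Proof.
move=> sE.
have E :
  (fun h : R => h^-1 *: (((f \o s) \o shift a) (h *: v) - (f \o s) a)) =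
  (fun h => h^-1 *: ((f \o shift (s a)) (h *: w) - f (s a))).
  by apply/funext => h /=; rewrite sE.
by move=> [df1 df2]; split; [rewrite /derivable E|rewrite /derive E].
Qed.

Lemma derive_affine {R : realType} {V W : normedModType R} (f : W -> R)
    (s : V -> W) (a v : V) (w : W) :
  (forall h : R, s (h *: v + a) = h *: w + s a) ->
  'D_v (f \o s) a = 'D_w f (s a).
Proof.
move=> sE; rewrite /derive [X in lim (X @ _)](_ : _ = (fun h : R =>
  h^-1 *: ((f \o shift (s a)) (h *: w) - f (s a))))//.
by apply/funext => h /=; rewrite sE.
Qed.

(** Passing to the line through [a] makes the one-variable chain rule and the inference of
    [is_derive] instances on scalar functions available. *)
Lemma is_derive_lineP {R : realType} {V : normedModType R} (f : V -> R)
    (a v : V) (df : R) :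
  is_derive a v f df <-> is_derive (0 : R) 1 (fun h => f (h *: v + a)) df.
Proof.
have E : (fun h : R => h^-1 *: ((f \o shift a) (h *: v) - f a)) =
  (fun h : R => h^-1 *:
    (((fun h => f (h *: v + a)) \o shift (0 : R)) (h *: (1 : R)) -
     f (0 *: v + a))).
  by apply: funext => h /=; rewrite scale0r add0r addr0 /GRing.scale/= mulr1.
split=> -[d1 d2]; split.
- by move: d1; rewrite /derivable E.
- by move: d2; rewrite /derive E.
- by rewrite /derivable E.
- by rewrite /derive E.
Qed.

Lemma is_derive_chain {R : realType} {V : normedModType R} (F : R -> R)
    (g : V -> R) (a v : V) (dF dg : R) :
  is_derive (g a) 1 F dF -> is_derive a v g dg ->
  is_derive a v (F \o g) (dF * dg).
Proof.
move=> hF /is_derive_lineP hg; apply/is_derive_lineP.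
by apply: is_derive1_comp; rewrite scale0r add0r.
Qed.

(** Both signs give the same formula, so [phi] can be differentiated without fixing the sign of the
    circulation. *)
Lemma is_derive_lnnorm {R : realType} (x : R) : x != 0 ->
  is_derive x 1 (fun y => ln `|y|) x^-1.
Proof.
move=> x0; have [xn|xp|xE] := ltgtP x 0; last by rewrite xE eqxx in x0.
- have := @is_derive_chain _ _ (@ln R) (fun y => - y) x 1 _ _ _
    (is_deriveNid x 1).
  move=> /(_ (- x)^-1); rewrite mulrN1 invrN opprK => H.
  apply: near_eq_is_derive (H _); last first.
    by rewrite -invrN; apply: is_derive1_ln; rewrite oppr_gt0.
  by near=> y => /=; rewrite ltr0_norm//; near: y; exact: lt_nbhsl.
- apply: near_eq_is_derive (is_derive1_ln xp).
  by near=> y => /=; rewrite gtr0_norm//; near: y; exact: lt_nbhsr.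
Unshelve. all: by end_near. Qed.

Lemma derive_scale {R : realType} {V : normedModType R} (f : V -> R)
    (a v : V) (c : R) : derivable f a v -> 'D_(c *: v) f a = c * 'D_v f a.
Proof.
move=> fav; have [->|c0] := eqVneq c 0; first by rewrite scale0r derive0 mul0r.
have /is_derive_lineP h : is_derive a v f ('D_v f a) by exact: DeriveDef.
apply: (@derive_val _ _ _ a (c *: v) f); apply/is_derive_lineP.
have := @is_derive1_comp _ _ ( *%R c) 0 ('D_v f a) c.
rewrite mulr0 mulrC => /(_ _ h) {}h.
apply: (near_eq_is_derive _ (h _)).
  by near=> t => /=; rewrite scalerA mulrC.
have := @is_deriveZ _ _ _ id c (0 : R) (1 : R) 1 _.
by rewrite /GRing.scale/= mulr1; apply.
Unshelve. all: by end_near. Qed.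

Lemma is_derive_pair {R : realType} {W W' : normedModType R}
    (f : R -> W) (g : R -> W') (a : R) (df : W) (dg : W') :
  is_derive a 1 f df -> is_derive a 1 g dg ->
  is_derive a 1 (fun x => (f x, g x)) (df, dg).
Proof.
move=> [/derivable1_diffP f1 f2] [/derivable1_diffP g1 g2].
have fg : differentiable (fun x => (f x, g x)) a by exact: differentiable_pair.
split; first exact/derivable1_diffP.
by rewrite deriveE// diff_pair// -!deriveE// f2 g2.
Qed.

(** Orbits of rotations are not lines, so directional derivatives do not suffice here and [f] must
    be Fréchet differentiable. *)
Lemma is_derive_curve {R : realType} {W : normedModType R}
    (f : W -> R) (c : R -> W) (a : R) (w : W) :
  is_derive a 1 c w -> differentiable f (c a) ->
  is_derive a 1 (f \o c) ('D_w f (c a)).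
Proof.
move=> [/derivable1_diffP c1 c2] fd.
have fcd : differentiable (f \o c) a by exact: differentiable_comp.
split; first exact/derivable1_diffP.
by rewrite deriveE// diff_comp//= -[X in 'd f _ X]deriveE// c2 deriveE.
Qed.

Lemma smooth_on_diff {R : realType} {V : normedModType R} (U : set V)
  (f : V -> R) a : smooth_on U f -> U a -> differentiable f a.
Proof. by move=> /(_ 1%N)[+ _]; exact. Qed.

Lemma smooth_on_derive {R : realType} {V : normedModType R} (U : set V)
  (f : V -> R) v : smooth_on U f -> smooth_on U ('D_v f).
Proof. by move=> sf n; have [_] := sf n.+1; exact. Qed.

Lemma smooth_on_derivable {R : realType} {V : normedModType R} (U : set V)
  (f : V -> R) a v : smooth_on U f -> U a -> derivable f a v.
Proof. by move=> sf Ua; apply/diff_derivable/(smooth_on_diff _ _ _ sf). Qed.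

(** * The circulation equation *)

Section Cartesian.
Context {R : realType}.
Implicit Types (f : R * R * R * R -> R) (a : R * R * R * R).

(** The orbit leaves the point with velocity (- y, x, 0, 0), which gives the infinitesimal generator
    of the rotations. *)
Lemma is_derive_rotz f (x y z t : R) : differentiable f (x, y, z, t) ->
  is_derive (0 : R) 1 (fun th => f (rotz th (x, y, z, t)))
    (x * Dy f (x, y, z, t) - y * Dx f (x, y, z, t)).
Proof.
move=> df; pose c := fun th : R =>
  (cos th * x - sin th * y, sin th * x + cos th * y, z, t).
have c0 : c 0 = (x, y, z, t).
  by rewrite /c cos0 sin0 !mul1r !mul0r subr0 add0r.
have dc : is_derive (0 : R) 1 c (- y, x, 0, 0).
  have dcos := is_derive_cos (0 : R); have dsin := is_derive_sin (0 : R).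
  have d1 : is_derive (0 : R) 1 (fun th => cos th * x - sin th * y) (- y).
    by apply: is_derive_eq; rewrite sin0 cos0 /GRing.scale/=; ring.
  have d2 : is_derive (0 : R) 1 (fun th => sin th * x + cos th * y) x.
    by apply: is_derive_eq; rewrite sin0 cos0 /GRing.scale/=; ring.
  have d3 (k : R) : is_derive (0 : R) 1 (fun=> k) 0 by exact: is_derive_cst.
  exact (is_derive_pair _ _ _ _ _
    (is_derive_pair _ _ _ _ _ (is_derive_pair _ _ _ _ _ d1 d2) (d3 z)) (d3 t)).
have := is_derive_curve f c 0 _ dc; rewrite c0 => /(_ df).
rewrite (_ : (- y, x, 0, 0) = x *: (0, 1, 0, 0) + - y *: (1, 0, 0, 0)).
  by rewrite deriveE// linearP linearZ/= -!deriveE// /GRing.scale/= mulNr.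
by congr (_, _, _, _) => /=; rewrite /GRing.scale/=; ring.
Qed.

(** Both sides of the rotation rule are differentiated at angle 0. The result is kept for all y, not
    only y = 0, because [axisymmetric_Dyy] differentiates it once more in y. *)
Lemma axisymmetric_infinitesimal (nu : R) (U : set (R * R * R * R)) (u : flow R)
    (x y z t : R) :
  axisymmetric_NS nu U u -> U (x, y, z, t) ->
  [/\ x * Dy (ux u) (x, y, z, t) - y * Dx (ux u) (x, y, z, t)
        = - uy u (x, y, z, t),
      x * Dy (uy u) (x, y, z, t) - y * Dx (uy u) (x, y, z, t)
        = ux u (x, y, z, t)
    & x * Dy (pres u) (x, y, z, t) - y * Dx (pres u) (x, y, z, t) = 0].
Proof.
move=> [[oU [sx sy sz sp] _ _] axi] Ua; set a := (x, y, z, t) in Ua *.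
have dx := is_derive_rotz _ _ _ _ _ (smooth_on_diff _ _ _ sx Ua).
have dy := is_derive_rotz _ _ _ _ _ (smooth_on_diff _ _ _ sy Ua).
have dp := is_derive_rotz _ _ _ _ _ (smooth_on_diff _ _ _ sp Ua).
have dcos := is_derive_cos (0 : R); have dsin := is_derive_sin (0 : R).
have ex : (fun th => ux u (rotz th a)) =
    (fun th => cos th * ux u a - sin th * uy u a).
  by apply/funext => th; case: (axi th a Ua).
have ey : (fun th => uy u (rotz th a)) =
    (fun th => sin th * ux u a + cos th * uy u a).
  by apply/funext => th; case: (axi th a Ua).
have ep : (fun th => pres u (rotz th a)) = cst (pres u a).
  by apply/funext => th; case: (axi th a Ua).
split.
- rewrite -(@derive_val _ _ _ _ _ _ _ dx) ex; apply: derive_val.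
  apply: is_derive_eq.
  by rewrite sin0 cos0 /GRing.scale/=; ring.
- rewrite -(@derive_val _ _ _ _ _ _ _ dy) ey; apply: derive_val.
  apply: is_derive_eq.
  by rewrite sin0 cos0 /GRing.scale/=; ring.
- by rewrite -(@derive_val _ _ _ _ _ _ _ dp) ep derive_cst.
Qed.

(** The y-derivative of x F - y G at y = 0: the term y B drops out and the derivative of y leaves -
    G. *)
Lemma is_derive_rot {V : normedModType R} (X Y F G : V -> R) (a e : V)
    (A B : R) :
  is_derive a e X 0 -> is_derive a e Y 1 -> Y a = 0 ->
  is_derive a e F A -> is_derive a e G B ->
  is_derive a e (fun b => X b * F b - Y b * G b) (X a * A - G a).
Proof.
move=> dX dY Y0 dF dG; apply: is_derive_eq.
by rewrite Y0 /GRing.scale/=; ring.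
Qed.

(* Differentiating x uy_y - y uy_x = ux in y gives uy_yy at theta = 0 without
   differentiating twice along the rotation. *)
Lemma axisymmetric_Dyy (nu : R) (U : set (R * R * R * R)) (u : flow R)
    (x z t : R) :
  axisymmetric_NS nu U u -> U (x, 0, z, t) ->
  x * Dy (Dy (uy u)) (x, 0, z, t)
  = Dx (uy u) (x, 0, z, t) + Dy (ux u) (x, 0, z, t).
Proof.
move=> NS Ua; set a := (x, 0, z, t) in Ua *.
have [[oU [sx sy sz sp] _ _] _] := NS.
pose X (b : R * R * R * R) := b.1.1.1; pose Y (b : R * R * R * R) := b.1.1.2.
(* Openness of [U] turns the pointwise identity into a local one, which may be differentiated. *)
have E : \near a, (fun b => X b * Dy (uy u) b - Y b * Dx (uy u) b) a = ux u a.
  apply: filterS (open_nbhs_nbhs (conj oU Ua)) => -[[[x' y'] z'] t'] Ub.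
  by have [] := axisymmetric_infinitesimal _ _ _ _ _ _ _ NS Ub.
pose e : R * R * R * R := (0, 1, 0, 0).
have dX : is_derive a e X 0.
  by apply/is_derive_lineP; rewrite /X/=; apply: is_derive_eq;
    rewrite /GRing.scale/=; ring.
have dY : is_derive a e Y 1.
  by apply/is_derive_lineP; rewrite /Y/=; apply: is_derive_eq;
    rewrite /GRing.scale/=; ring.
have dDy : is_derive a e (Dy (uy u)) (Dy (Dy (uy u)) a).
  apply/derivableP; apply: smooth_on_derivable Ua; exact: smooth_on_derive.
have dDx : is_derive a e (Dx (uy u)) (Dy (Dx (uy u)) a).
  apply/derivableP; apply: smooth_on_derivable Ua; exact: smooth_on_derive.
have [_] := near_eq_is_derive E
  (is_derive_rot _ _ _ _ _ _ _ _ dX dY erefl dDy dDx).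
by move=> h; rewrite [X in _ = _ + X]h addrC subrK.
Qed.
End Cartesian.

(** * Restriction to the half-plane theta = 0 *)

Section Meridional.
Context {R : realType}.
Implicit Types (m v : R * R * R) (U : set (R * R * R * R)) (u : flow R).

Lemma lift0_line m v (h : R) : lift0 (h *: v + m) = h *: lift0 v + lift0 m.
Proof. by congr (_, _, _, _); rewrite /= /GRing.scale/= mulr0 addr0. Qed.

Lemma continuous_lift0 : continuous (@lift0 R).
Proof.
move=> m; have c11 : x.1.1 @[x --> m] --> m.1.1.
  by apply: (@cvg_comp _ _ _ fst fst); exact: cvg_fst.
have c12 : x.1.2 @[x --> m] --> m.1.2.
  by apply: (@cvg_comp _ _ _ fst snd); [exact: cvg_fst|exact: cvg_snd].
have c2 : x.2 @[x --> m] --> m.2 by exact: cvg_snd.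
exact: (cvg_pair (cvg_pair (cvg_pair c11 (cvg_cst 0)) c12) c2).
Qed.

Lemma is_derive_lift0 (f : R * R * R * R -> R) m v :
  derivable f (lift0 m) (lift0 v) ->
  is_derive m v (f \o @lift0 R) ('D_(lift0 v) f (lift0 m)).
Proof.
move=> /derivableP; apply: is_derive_affine => h; exact: lift0_line.
Qed.

Lemma is_derive_rcoord m v : is_derive m v (@rcoord R) v.1.1.
Proof.
apply/is_derive_lineP; rewrite /rcoord/=; apply: is_derive_eq.
by rewrite /GRing.scale/=; ring.
Qed.

(** The pointwise part of [swirl_region]; unlike membership in [D], it is an open condition. *)
Definition swirl_point U u m : Prop :=
  [/\ U (lift0 m), 0 < rcoord m & Gamma u m != 0].

Lemma near_swirl_point (nu : R) U u m : axisymmetric_NS nu U u ->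
  swirl_point U u m -> \near m, swirl_point U u m.
Proof.
move=> [[oU [_ sy _ _] _ _] _] [Um rm Gm].
have c1 : {for m, continuous (@rcoord R)}.
  exact: (cvg_comp _ _ cvg_fst cvg_fst).
have c2 : {for m, continuous (Gamma u)}.
  apply: cvgM => //; apply: (cvg_comp _ _ (@continuous_lift0 m)).
  exact: (sy 0%N).
have n3 : \near m, Gamma u m != 0.
  by exact: (@cvgr_neq0 _ _ _ _ (nbhs_filter m) _ _ c2 Gm).
have n1 : \near m, U (lift0 m).
  by apply: (@continuous_lift0 m); exact: open_nbhs_nbhs.
have n2 : \near m, 0 < rcoord m.
  by exact: (@cvgr_gt _ _ _ (nbhs_filter m) _ _ c1 0 rm).
apply: (@filterS3 _ (nbhs m) _ _ _ _ _ _ n1 n2 n3) => m' h1 h2 h3.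
by split.
Qed.

(** The azimuthal momentum equation in cylindrical form. At theta = 0 one has [Dy] of uy equal to ux
    / r, [Dy] of ux equal to - uy / r and [Dy] of the pressure equal to 0, which removes every
    y-derivative. *)
Lemma swirl_equation (nu : R) U u m : axisymmetric_NS nu U u ->
  swirl_point U u m ->
  let a := lift0 m in let r := rcoord m in
  Dt (uy u) a + (ux u a * Dx (uy u) a + uy u a * (ux u a / r)
    + uz u a * Dz (uy u) a)
  = nu * (Dx (Dx (uy u)) a + (Dx (uy u) a - uy u a / r) / r
    + Dz (Dz (uy u)) a).
Proof.
move=> NS [Um rm _]; have [[_ _ _ mom] _] := NS.
case: m Um rm => -[r z] t Um; rewrite /rcoord/= => rm.
have r0 : r != 0 by rewrite gt_eqF.
have [_ + _] := mom _ Um; rewrite /advect /laplacian /lift0/=.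
have [h1 h2 h3] := axisymmetric_infinitesimal _ _ _ _ _ _ _ NS Um.
have h4 := axisymmetric_Dyy _ _ _ _ _ _ NS Um.
move: h1 h2 h3 h4; rewrite /=.
move: (Dy (pres u) _) (Dx (pres u) _) => py px.
move: (Dy (Dy (uy u)) _) => dyy; move: (Dx (Dx (uy u)) _) => dxx.
move: (Dz (Dz (uy u)) _) => dzz.
move: (Dy (uy u) _) (Dx (uy u) _) (Dz (uy u) _) (Dt (uy u) _) => dy dx dz dt.
move: (Dy (ux u) _) (Dx (ux u) _) => ey ex.
move: (ux u _) (uy u _) (uz u _) => a b c.
rewrite !mul0r !subr0 => h1 h2 h3 h4 e.
have eyE : ey = - b / r by rewrite -h1 mulrC mulKf.
have dyE : dy = a / r by rewrite -h2 mulrC mulKf.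
have pyE : py = 0 by apply: (mulfI r0); rewrite h3 mulr0.
have dyyE : dyy = (dx - b / r) / r.
  by rewrite -mulNr -eyE -h4 mulrC mulKf.
by move: e; rewrite dyE pyE dyyE oppr0 add0r.
Qed.

Lemma meridional_incompressible (nu : R) U u m : axisymmetric_NS nu U u ->
  swirl_point U u m ->
  let a := lift0 m in
  Dx (ux u) a + ux u a / rcoord m + Dz (uz u) a = 0.
Proof.
move=> NS [Um rm _]; have [[_ _ div _] _] := NS.
case: m Um rm => -[r z] t Um; rewrite /rcoord/= => rm.
have r0 : r != 0 by rewrite gt_eqF.
have [_ h2 _] := axisymmetric_infinitesimal _ _ _ _ _ _ _ NS Um.
have := div _ Um; rewrite /lift0/=.
move: h2; rewrite /=.
move: (Dy (uy u) _) (Dx (uy u) _) (Dx (ux u) _) (ux u _) => dy dx ex a.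
rewrite mul0r subr0 => h2; rewrite (_ : a / r = dy)//.
by rewrite -h2 mulrC mulKf.
Qed.

End Meridional.

(** * The continuity identity *)

Section LogDerivative.
Context {R : realType} {V : normedModType R}.
Implicit Types (f g : V -> R) (a v : V).

Lemma is_derive_lnnorm_comp g a v (dg : R) : g a != 0 -> is_derive a v g dg ->
  is_derive a v (fun b => ln `|g b|) (dg / g a).
Proof.
move=> ga0 dg'; rewrite mulrC.
exact: (is_derive_chain _ _ _ _ _ _ (is_derive_lnnorm _ ga0) dg').
Qed.

Lemma is_derive_quotient g f a v (dg df : R) : f a != 0 ->
  is_derive a v g dg -> is_derive a v f df ->
  is_derive a v (fun b => g b / f b) (dg / f a - g a * df / f a ^+ 2).
Proof.
move=> fa0 dg' df'.
have dV : is_derive a v (fun b => (f b)^-1) (- (f a) ^- 2 * df).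
  by split; [apply: derivableV|rewrite deriveV// derive_val].
have dM := is_deriveM dg' dV.
apply: is_derive_eq dM _; rewrite /GRing.scale/=; field.
by rewrite ?fa0.
Qed.

Lemma is_derive_exp_lincomb f g a v (p k df dg : R) : 0 < g a ->
  is_derive a v f df -> is_derive a v g dg ->
  is_derive a v (fun b => expR (p * f b - k * ln (g b)))
    (expR (p * f a - k * ln (g a)) * (p * df - k * dg / g a)).
Proof.
move=> ga0 df' dg'.
have dl : is_derive a v (fun b => ln (g b)) ((g a)^-1 * dg).
  exact: (is_derive_chain _ _ _ _ _ _ (is_derive1_ln ga0) dg').
have dF := is_deriveB (is_deriveZ p df') (is_deriveZ k dl).
have := is_derive_chain expR _ a v _ _ (is_derive_expR _) dF.
rewrite /GRing.scale/= => h.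
apply: is_derive_eq h _; rewrite /=; congr (_ * (_ - _)).
by rewrite -!mulrA [_^-1 * _]mulrC.
Qed.

End LogDerivative.

Section Meridional2.
Context {R : realType}.
Implicit Types (m v : R * R * R) (U : set (R * R * R * R)) (u : flow R).

Lemma is_derive_Gamma (nu : R) U u m v : axisymmetric_NS nu U u ->
  U (lift0 m) ->
  is_derive m v (Gamma u) (v.1.1 * uy u (lift0 m)
    + rcoord m * 'D_(lift0 v) (uy u) (lift0 m)).
Proof.
move=> [[oU [_ sy _ _] _ _] _] Um.
have h := is_deriveM (is_derive_rcoord m v)
  (is_derive_lift0 _ _ _ (smooth_on_derivable _ _ _ (lift0 v) sy Um)).
apply: is_derive_eq h _.
by rewrite /GRing.scale/= addrC [_ * v.1.1]mulrC.
Qed.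

Lemma is_derive_phi (nu : R) U u m v : axisymmetric_NS nu U u ->
  swirl_point U u m ->
  is_derive m v (phi u) ((v.1.1 * uy u (lift0 m)
    + rcoord m * 'D_(lift0 v) (uy u) (lift0 m)) / Gamma u m).
Proof.
move=> NS [Um _ Gm].
exact: (is_derive_lnnorm_comp _ _ _ _ Gm (is_derive_Gamma _ _ _ _ _ NS Um)).
Qed.

(** This is (ln G)'' = G'' / G - (G' / G)^2 for G = r u^theta; the factor 2 is the cross term of the
    product, r being affine along [v]. *)
Lemma is_derive2_phi (nu : R) U u m v : axisymmetric_NS nu U u ->
  swirl_point U u m ->
  is_derive m v ('D_v (phi u))
    ((2 * v.1.1 * 'D_(lift0 v) (uy u) (lift0 m)
     + rcoord m * 'D_(lift0 v) ('D_(lift0 v) (uy u)) (lift0 m)) / Gamma u m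
     - ((v.1.1 * uy u (lift0 m)
    + rcoord m * 'D_(lift0 v) (uy u) (lift0 m)) / Gamma u m) ^+ 2).
Proof.
move=> NS sm; have [Um rm Gm] := sm.
have [[oU [_ sy _ _] _ _] _] := NS.
pose w := uy u \o @Defs.lift0 R.
pose dw := 'D_(lift0 v) (uy u) \o @Defs.lift0 R.
have dw1 : is_derive m v w (dw m).
  exact: is_derive_lift0 (smooth_on_derivable _ _ _ (lift0 v) sy Um).
pose ddw := 'D_(lift0 v) ('D_(lift0 v) (uy u)) (lift0 m).
have dw2 : is_derive m v dw ddw.
  apply: is_derive_lift0; apply: smooth_on_derivable Um.
  exact: smooth_on_derive.
(* The first-derivative formula holds at all nearby swirl points, so the quotient can be
   differentiated in place of ['D_v (phi u)]. *)
have nE : \near m, (v.1.1 * w m + rcoord m * dw m) / Gamma u m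
    = 'D_v (phi u) m.
  apply: filterS (near_swirl_point _ _ _ _ NS sm) => m' sm'.
  by have [_ ->] := is_derive_phi _ _ _ _ v NS sm'.
apply: near_eq_is_derive nE _.
have dN : is_derive m v (fun m => v.1.1 * w m + rcoord m * dw m)
    (2 * v.1.1 * dw m + rcoord m * ddw).
  apply: is_derive_eq (is_deriveD (is_deriveZ v.1.1 dw1)
    (is_deriveM (is_derive_rcoord m v) dw2)) _.
  by rewrite /GRing.scale/=; ring.
have dQ := is_derive_quotient _ _ _ _ _ _ Gm dN
  (is_derive_Gamma _ _ _ _ v NS Um).
apply: is_derive_eq dQ _; congr (_ - _).
by rewrite expr_div_n -expr2.
Qed.

Lemma rhoE U u m (p k : R) : swirl_point U u m ->
  rho p k u m = expR (p * phi u m - k * ln (rcoord m)).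
Proof.
move=> [_ rm Gm]; rewrite /rho /powR normr_eq0 (negbTE Gm) gt_eqF//.
by rewrite -expRD mulNr.
Qed.

Lemma is_derive_rho (nu : R) U u m v (p k : R) : axisymmetric_NS nu U u ->
  swirl_point U u m ->
  is_derive m v (rho p k u)
    (rho p k u m * (p * 'D_v (phi u) m - k * v.1.1 / rcoord m)).
Proof.
move=> NS sm; have [Um rm Gm] := sm.
have nE : \near m, expR (p * phi u m - k * ln (rcoord m)) = rho p k u m.
  apply: filterS (near_swirl_point _ _ _ _ NS sm) => m' sm'.
  by rewrite (rhoE _ _ _ _ _ sm').
apply: near_eq_is_derive nE _; rewrite (rhoE _ _ _ _ _ sm).
apply: is_derive_exp_lincomb => //; last exact: is_derive_rcoord.
by apply/derivableP; have [] := is_derive_phi _ _ _ _ v NS sm.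
Qed.

End Meridional2.

Section Continuity.
Context {R : realType}.

Lemma is_derive_current {V : normedModType R} (f b g : V -> R) (a v : V)
    (c df db dg : R) :
  is_derive a v f df -> is_derive a v b db -> is_derive a v g dg ->
  is_derive a v (fun x => f x * (b x - c * g x))
    (df * (b a - c * g a) + f a * (db - c * dg)).
Proof.
move=> df' db' dg'.
apply: is_derive_eq (is_deriveM df' (is_deriveB db' (is_deriveZ c dg'))) _.
rewrite (_ : (b - c *: g) a = b a - c * g a)//.
by rewrite /GRing.scale/=; ring.
Qed.

(** Here w is u^theta and f stands for phi. The swirl equation amounts to f_t + b.grad f = nu (f_rr
    + f_zz + |grad f|^2 - f_r / r), and incompressibility to div b = - ur / r. The second
    derivatives of f then cancel against the divergence of - p nu grad f. The literal factors 1 and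
    0 are the r-components of the coordinate vectors, kept so that the derivative formulas unify
    with the hypotheses. *)
Lemma continuity_algebra (nu p k r w ur uz wr wz wt wrr wzz urr uzz rho fr fz ft
    frr fzz : R) :
  r != 0 -> w != 0 ->
  wt + (ur * wr + w * (ur / r) + uz * wz)
    = nu * (wrr + (wr - w / r) / r + wzz) ->
  urr + ur / r + uzz = 0 ->
  fr = (1 * w + r * wr) / (r * w) ->
  fz = (0 * w + r * wz) / (r * w) ->
  ft = (0 * w + r * wt) / (r * w) ->
  frr = (2 * 1 * wr + r * wrr) / (r * w) - ((1 * w + r * wr) / (r * w)) ^+ 2 ->
  fzz = (2 * 0 * wz + r * wzz) / (r * w) - ((0 * w + r * wz) / (r * w)) ^+ 2 ->
  rho * (p * ft - k * 0 / r)
  + ((rho * (p * fr - k * 1 / r)) * (ur - p * nu * fr)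
       + rho * (urr - p * nu * frr)
     + ((rho * (p * fz - k * 0 / r)) * (uz - p * nu * fz)
       + rho * (uzz - p * nu * fzz)))
  = rho * ((k + 1) * (- ur / r)
     + p * nu * ((k - 1) * (fr / r) - (p - 1) * (fr ^+ 2 + fz ^+ 2))).
Proof.
move=> r0 w0 e1 e2.
have -> : urr = - (ur / r) - uzz by lra.
have {}e1 : wt = nu * (wrr + (wr - w / r) / r + wzz)
  - (ur * wr + w * (ur / r) + uz * wz) by rewrite -e1 addrK.
move=> -> -> -> -> ->; rewrite e1; field.
by rewrite r0 w0.
Qed.

Lemma continuity_equation (nu p k : R) (U : set (R * R * R * R)) (u : flow R)
    (m : R * R * R) : axisymmetric_NS nu U u -> swirl_point U u m ->
  d_t (rho p k u) m
    + flat_div (fun m' => rho p k u m' *: current_velocity nu p u m') m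
  = rho p k u m *
     ((k + 1) * compression u m
      + p * nu * ((k - 1) * (d_r (phi u) m / rcoord m)
                  - (p - 1) * sqnorm (grad (phi u) m))).
Proof.
move=> NS sm; have [Um rm Gm] := sm.
have [[oU [sx sy sz _] _ _] _] := NS.
pose er : R * R * R := (1, 0, 0); pose ez : R * R * R := (0, 1, 0).
pose et : R * R * R := (0, 0, 1).
have w0 : utheta u m != 0.
  by apply: contra_neq Gm; rewrite /Gamma => ->; rewrite mulr0.
have r0 : rcoord m != 0 by rewrite gt_eqF.
have dur : is_derive m er (ur u) (Dx (ux u) (lift0 m)).
  exact: is_derive_lift0 (smooth_on_derivable _ _ _ (lift0 er) sx Um).
have duz : is_derive m ez (uzm u) (Dz (uz u) (lift0 m)).
  exact: is_derive_lift0 (smooth_on_derivable _ _ _ (lift0 ez) sz Um).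
have pr := @derive_val _ _ _ _ _ _ _ (is_derive_phi _ _ _ _ er NS sm).
have pz := @derive_val _ _ _ _ _ _ _ (is_derive_phi _ _ _ _ ez NS sm).
have pt := @derive_val _ _ _ _ _ _ _ (is_derive_phi _ _ _ _ et NS sm).
have dpr := is_derive2_phi _ _ _ _ er NS sm.
have dpz := is_derive2_phi _ _ _ _ ez NS sm.
have rr := is_derive_rho _ _ _ _ er p k NS sm.
have rz := is_derive_rho _ _ _ _ ez p k NS sm.
have rt := is_derive_rho _ _ _ _ et p k NS sm.
have jr := is_derive_current _ _ _ _ _ (p * nu) _ _ _ rr dur dpr.
have jz := is_derive_current _ _ _ _ _ (p * nu) _ _ _ rz duz dpz.
have e1 := swirl_equation _ _ _ _ NS sm.
have e2 := meridional_incompressible _ _ _ _ NS sm.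
rewrite /flat_div.
have -> : d_r (fun m' => (rho p k u m' *: current_velocity nu p u m').1) m
  = _ := @derive_val _ _ _ _ _ _ _ jr.
have -> : d_z (fun m' => (rho p k u m' *: current_velocity nu p u m').2) m
  = _ := @derive_val _ _ _ _ _ _ _ jz.
have -> : d_t (rho p k u) m = _ := @derive_val _ _ _ _ _ _ _ rt.
exact: (continuity_algebra _ _ _ _ _ _ _ _ _ _ _ _ _ _ _ _ _ _ _ _
  r0 w0 e1 e2 pr pz pt erefl erefl).
Qed.

End Continuity.

(** * Scaling of the current action *)

Section ScalingMaps.
Local Open Scope ereal_scope.

(** Stated with preimages because [region_rescale] is one, and because it then says that the
    pushforward of [mu] is [c] times [mu]. *)
Definition scales_measure {d} {T : measurableType d} {R : realType}
    (mu : set T -> \bar R) (s : T -> T) (c : R) : Prop :=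
  [/\ measurable_fun setT s, (0 < c)%R &
      forall A, measurable A -> mu (s @^-1` A) = c%:E * mu A].

Lemma ge0_integral_scales d (T : measurableType d) {R : realType}
    (mu : {measure set T -> \bar R}) (s : T -> T) (c : R) (f : T -> \bar R) :
  scales_measure mu s c -> measurable_fun setT f -> (forall x, 0 <= f x) ->
  \int[mu]_x f (s x) = c%:E * \int[mu]_x f x.
Proof.
move=> [ms c0 sE] mf f0.
have -> : \int[mu]_x f (s x) = \int[pushforward mu s]_x f x.
  by rewrite ge0_integral_pushforward.
pose r : {nonneg R} := NngNum (ltW c0).
rewrite -(ge0_integral_mscale mu measurableT r mf)//.
by apply: eq_measure_integral => A mA _; exact: sE.
Qed.

(** A section of the preimage is the preimage under [s2] of a section of [A], taken at [s1 x]: [c2]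
    comes from the inner measure and [c1] from the outer integral. *)
Lemma scales_product d1 d2 (T1 : measurableType d1) (T2 : measurableType d2)
    {R : realType} (m1 : {measure set T1 -> \bar R})
    (m2 : {sigma_finite_measure set T2 -> \bar R}) (s1 : T1 -> T1)
    (s2 : T2 -> T2) (c1 c2 : R) :
  scales_measure m1 s1 c1 -> scales_measure m2 s2 c2 ->
  scales_measure (m1 \x m2) (fun x => (s1 x.1, s2 x.2)) (c1 * c2)%R.
Proof.
move=> S1 S2; have [ms1 c10 _] := S1; have [ms2 c20 s2E] := S2.
split; first by apply: measurable_fun_pair; apply: measurableT_comp.
  exact: mulr_gt0.
move=> A mA; rewrite /product_measure1.
have mx : measurable_fun setT (m2 \o xsection A).
  exact: measurable_fun_xsection.
transitivity (\int[m1]_x (c2%:E * (m2 \o xsection A) (s1 x))).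
  apply: eq_integral => x _ /=.
  rewrite -s2E; last exact: measurable_xsection.
  by congr (m2 _); apply/seteqP; split => y; rewrite /xsection/= !inE.
rewrite (ge0_integral_scales _ _ _ _ _
  (fun x => c2%:E * (m2 \o xsection A) x) S1).
- rewrite ge0_integralZl//; last by rewrite lee_fin ltW.
  by rewrite muleA -EFinM.
- exact: measurable_funeM.
- by move=> x; rewrite mule_ge0// lee_fin ltW.
Qed.

(** By uniqueness of Lebesgue measure: 1 / L times the pushforward gives each half-open interval its
    length. *)
Lemma scales_lebesgue {R : realType} (L : R) : (0 < L)%R ->
  scales_measure (@lebesgue_measure R) (fun x => x / L)%R L.
Proof.
move=> L0; have ms : measurable_fun setT
    ((fun x => x / L)%R : measurableTypeR R -> measurableTypeR R).
  exact: mulrr_measurable.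
split => // A mA.
have Li0 : (0 <= L^-1)%R by rewrite invr_ge0 ltW.
pose nu : {measure set (measurableTypeR R) -> \bar R} :=
  measure_function_pushforward__canonical__measure_function_Measure
    (@lebesgue_measure R) ms.
suff -> : lebesgue_measure A = mscale (NngNum Li0) nu A.
  by rewrite /mscale/= muleA -EFinM divff ?gt_eqF// mul1e.
apply: lebesgue_measure_unique => //= _ [[a b]] _ <-.
rewrite /mscale/= /pushforward.
have -> : (fun x => x / L)%R @^-1` `]a, b] = `](a * L)%R, (b * L)%R]%classic.
  apply/seteqP; split => x /=; rewrite !in_itv/=.
    by rewrite ltr_pdivlMr// ler_pdivrMr.
  by rewrite ltr_pdivlMr// ler_pdivrMr.
rewrite !lebesgue_measure_itv/= !lte_fin ltr_pM2r//.
case: ifP => _; last by rewrite mule0.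
by rewrite -!EFinD -EFinM -mulrBl mulrC mulfK// gt_eqF.
Qed.

End ScalingMaps.

(* The Lebesgue integral of a nonnegative function is a supremum over simple
   functions, so neither scaling nor monotonicity needs a measurable integrand;
   this spares a measurability proof for the integrand of the action. *)
Section NonmeasurableIntegrand.
Local Open Scope ereal_scope.
Import HBNNSimple.
Context {d} {T : measurableType d} {R : realType}
  (mu : {measure set T -> \bar R}).
Implicit Types f g : T -> \bar R.

Lemma ge0_integral_leP f (y : \bar R) : (forall x, 0 <= f x) ->
  (forall h : {nnsfun T >-> R}, (forall x, (h x)%:E <= f x) ->
     \int[mu]_x (h x)%:E <= y) ->
  \int[mu]_x f x <= y.
Proof.
move=> f0 H; rewrite ge0_integralTE//; apply/ge_ereal_sup => /= _ [h hf <-].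
by rewrite -integralT_nnsfun; exact: H.
Qed.

Lemma ge0_le_integralT f g : (forall x, 0 <= f x) -> (forall x, f x <= g x) ->
  \int[mu]_x f x <= \int[mu]_x g x.
Proof.
move=> f0 fg; have g0 x : 0 <= g x by exact: le_trans (fg x).
rewrite ge0_integralTE// (ge0_integralTE _ g0); apply: le_ereal_sup.
by move=> _ [h hf <-]; exists h => // x; exact: le_trans (fg x).
Qed.

Lemma measurable_nnsfunE (h : {nnsfun T >-> R}) :
  measurable_fun setT (fun x => (h x)%:E).
Proof. exact/measurable_EFinP. Qed.

(** For a simple [h] below [f] the change of variables is exact, and [h \o s] lies below
    [f \o s]. *)
Let ge0_integral_scale_ge (s : T -> T) (c : R) f :
  scales_measure mu s c -> (forall x, 0 <= f x) ->
  \int[mu]_x f x <= (c^-1)%:E * \int[mu]_x f (s x).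
Proof.
move=> S f0; have [_ c0 _] := S; apply: ge0_integral_leP => // h hf.
have h0 x : 0 <= (h x)%:E by rewrite lee_fin.
have E := ge0_integral_scales _ _ _ _ _ _ S (measurable_nnsfunE h) h0.
have -> : \int[mu]_x (h x)%:E = (c^-1)%:E * \int[mu]_x (h (s x))%:E.
  by rewrite E muleA -EFinM mulVf ?gt_eqF// mul1e.
apply: lee_wpmul2l; first by rewrite lee_fin invr_ge0 ltW.
by apply: ge0_le_integralT => // x.
Qed.

(** The reverse inequality is the same one for the inverse scaling [s'] and the function
    [f \o s]. *)
Lemma ge0_integral_scale (s s' : T -> T) (c : R) f :
  scales_measure mu s c -> scales_measure mu s' c^-1 -> cancel s' s ->
  (forall x, 0 <= f x) ->
  \int[mu]_x f (s x) = c%:E * \int[mu]_x f x.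
Proof.
move=> S S' sK f0; have [_ c0 _] := S.
apply/eqP; rewrite eq_le; apply/andP; split.
  have := ge0_integral_scale_ge _ _ (f \o s) S' (fun x => f0 (s x)).
  rewrite invrK => /le_trans; apply; apply: lee_wpmul2l.
    by rewrite lee_fin ltW.
  by rewrite (eq_integral f)// => x _ /=; rewrite sK.
have := ge0_integral_scale_ge _ _ _ S f0.
move=> /(lee_wpmul2l (_ : 0 <= c%:E)) => /(_ _)/le_trans; apply.
  by rewrite lee_fin ltW.
by rewrite muleA -EFinM divff ?gt_eqF// mul1e.
Qed.

Let ge0_integralZl_le (K : R) f : (0 < K)%R -> (forall x, 0 <= f x) ->
  \int[mu]_x (K%:E * f x) <= K%:E * \int[mu]_x f x.
Proof.
move=> K0 f0; apply: ge0_integral_leP.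
  by move=> x; rewrite mule_ge0// lee_fin ltW.
move=> h hf; have h0 x : 0 <= (h x)%:E by rewrite lee_fin.
have -> : \int[mu]_x (h x)%:E = K%:E * \int[mu]_x ((K^-1)%:E * (h x)%:E).
  rewrite ge0_integralZl//.
  - by rewrite muleA -EFinM divff ?gt_eqF// mul1e.
  - exact: measurable_nnsfunE.
  - by rewrite lee_fin invr_ge0 ltW.
apply: lee_wpmul2l; first by rewrite lee_fin ltW.
apply: ge0_le_integralT => x.
  by rewrite mule_ge0// lee_fin invr_ge0 ltW.
have -> : f x = (K^-1)%:E * (K%:E * f x).
  by rewrite muleA -EFinM mulVf ?gt_eqF// mul1e.
by apply: lee_wpmul2l; [rewrite lee_fin invr_ge0 ltW|].
Qed.

(** Again one inequality used twice, the second time with [K^-1] and the function [K f]. *)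
Lemma ge0_integralZlT (K : R) f : (0 < K)%R -> (forall x, 0 <= f x) ->
  \int[mu]_x (K%:E * f x) = K%:E * \int[mu]_x f x.
Proof.
move=> K0 f0; apply/eqP; rewrite eq_le ge0_integralZl_le//=.
have Kf0 x : 0 <= K%:E * f x by rewrite mule_ge0// lee_fin ltW.
have := @ge0_integralZl_le K^-1 _ _ Kf0; rewrite invr_gt0 => /(_ K0).
rewrite (eq_integral f); last first.
  by move=> x _; rewrite muleA -EFinM mulVf ?gt_eqF// mul1e.
move=> /(lee_wpmul2l (_ : 0 <= K%:E)) => /(_ _)/le_trans; apply.
  by rewrite lee_fin ltW.
by rewrite muleA -EFinM divff ?gt_eqF// mul1e.
Qed.

End NonmeasurableIntegrand.

(** * Change of variables in the action *)

Section ActionScaling.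
Context {R : realType}.
Implicit Types (m v : R * R * R) (U : set (R * R * R * R)) (u : flow R).

Definition parabolic (L : R) m : R * R * R :=
  (m.1.1 / L, m.1.2 / L, m.2 / L ^+ 2).

Local Notation mu3 :=
  ((@lebesgue_measure R \x @lebesgue_measure R) \x @lebesgue_measure R)%E.

Lemma scales_parabolic (L : R) : 0 < L ->
  scales_measure mu3 (parabolic L) (L ^+ 4).
Proof.
move=> L0; have L20 : 0 < L ^+ 2 by rewrite exprn_gt0.
have S := scales_product _ _ _ _ _ _ _ _ _ _
  (scales_product _ _ _ _ _ _ _ _ _ _ (scales_lebesgue _ L0)
     (scales_lebesgue _ L0)) (scales_lebesgue _ L20).
by rewrite (_ : L ^+ 4 = L * L * L ^+ 2)//; ring.
Qed.

Lemma parabolicK (L : R) : 0 < L -> cancel (parabolic L^-1) (parabolic L).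
Proof.
move=> L0 -[[r z] t]; have Ln0 : L != 0 by rewrite gt_eqF.
by rewrite /parabolic/= exprVn !invrK !mulfK// expf_neq0.
Qed.

Lemma parabolic_line (L : R) m v (h : R) :
  parabolic L (h *: v + m) = h *: parabolic L v + parabolic L m.
Proof. by congr (_, _, _); rewrite /= /GRing.scale/= mulrDl mulrA. Qed.

Lemma ns_rescale_comp (L : R) u m (a := lift0 m) :
  [/\ ux (ns_rescale L u) a = L^-1 * ux u (lift0 (parabolic L m)),
      uy (ns_rescale L u) a = L^-1 * uy u (lift0 (parabolic L m))
    & uz (ns_rescale L u) a = L^-1 * uz u (lift0 (parabolic L m))].
Proof.
by rewrite /a; case: m a => -[r z] t _; rewrite /= /Defs.lift0/= mul0r.
Qed.

Lemma Gamma_rescale (L : R) u m :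
  Gamma (ns_rescale L u) m = Gamma u (parabolic L m).
Proof.
rewrite /Gamma /utheta; have [_ -> _] := ns_rescale_comp L u m.
by rewrite mulrA.
Qed.

Lemma phi_rescale (L : R) u : phi (ns_rescale L u) = phi u \o parabolic L.
Proof. by apply/funext => m; rewrite /phi Gamma_rescale. Qed.

(** Drift and grad phi both gain the factor 1 / L while [nu] is unchanged, so [p] leaves no trace in
    the weight. *)
Lemma current_velocity_rescale (nu p L : R) U u m :
  axisymmetric_NS nu U u -> swirl_point U u (parabolic L m) ->
  current_velocity nu p (ns_rescale L u) m
  = L^-1 *: current_velocity nu p u (parabolic L m).
Proof.
move=> NS sm.
have d v : derivable (phi u) (parabolic L m) v.
  by have [] := is_derive_phi _ _ _ _ v NS sm.
have er : parabolic L (1, 0, 0) = L^-1 *: (1, 0, 0).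
  by congr (_, _, _); rewrite /= /GRing.scale/= ?mul0r ?mulr0 ?mul1r ?mulr1.
have ez : parabolic L (0, 1, 0) = L^-1 *: (0, 1, 0).
  by congr (_, _, _); rewrite /= /GRing.scale/= ?mul0r ?mulr0 ?mul1r ?mulr1.
have gr : grad (phi (ns_rescale L u)) m = L^-1 *: grad (phi u) (parabolic L m).
  rewrite phi_rescale /grad /d_r /d_z.
  rewrite (derive_affine _ _ _ _ _ (parabolic_line L m _)) er derive_scale//.
  by rewrite (derive_affine _ _ _ _ _ (parabolic_line L m _)) ez derive_scale.
have dr : drift (ns_rescale L u) m = L^-1 *: drift u (parabolic L m).
  rewrite /drift /ur /uzm.
  by have [-> _ ->] := ns_rescale_comp L u m.
by rewrite /current_velocity gr dr scalerBr !scalerA [L^-1 * _]mulrC.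
Qed.

Lemma sqnormZ (c : R) (w : R * R) : sqnorm (c *: w) = c ^+ 2 * sqnorm w.
Proof. by rewrite /sqnorm /= /GRing.scale/= !exprMn mulrDr. Qed.

Lemma rho_rescale (p k L : R) u m : 0 < L -> 0 < rcoord m ->
  rho p k (ns_rescale L u) m = L `^ (- k) * rho p k u (parabolic L m).
Proof.
move=> L0 r0; rewrite /rho Gamma_rescale mulrCA -powRM ?ltW//.
  by rewrite /rcoord/= mulrCA divff ?gt_eqF// mulr1.
by rewrite /rcoord/= divr_gt0.
Qed.

Lemma sqnorm_ge0 (w : R * R) : 0 <= sqnorm w.
Proof. by rewrite addr_ge0// sqr_ge0. Qed.

Lemma rho_ge0 (p k : R) u m : 0 <= rho p k u m.
Proof. by rewrite mulr_ge0// powR_ge0. Qed.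

Lemma action_scale_weight (nu p k : R) :
  has_scale_weight nu (action nu p k) (2 - k).
Proof.
move=> L U u D L0 NS [mD sD].
have Ln0 : L != 0 by rewrite gt_eqF.
(* Extending the integrands by zero moves the change of variables to the whole space; off the region
   both sides vanish. *)
rewrite /action integral_mkcond [X in _ = (_ * X)%E]integral_mkcond.
set F := fun m => (rho p k u m * sqnorm (current_velocity nu p u m))%:E.
have FD0 m : (0 <= (F \_ D) m)%E.
  by rewrite /patch; case: ifP => // _;
    rewrite lee_fin mulr_ge0 ?rho_ge0 ?sqnorm_ge0.
(* The factor of the integrand: L^-k from [rho] and L^-2 from the squared velocity. The Jacobian L^4
   is split off separately. *)
pose K : R := L `^ (- k) * L^-1 ^+ 2.
have K0 : 0 < K by rewrite mulr_gt0 ?powR_gt0// exprn_gt0 ?invr_gt0.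
have -> : L `^ (2 - k) = K * L ^+ 4.
  rewrite powRD; last by rewrite Ln0 implybT.
  rewrite (powR_mulrn 2%N) ?ltW// /K exprVn mulrC -mulrA; congr (_ * _).
  by field.
rewrite EFinM -muleA.
rewrite -(ge0_integral_scale _ _ _ _ _ (scales_parabolic _ L0) _
  (parabolicK _ L0) FD0); last first.
  by rewrite -exprVn; apply: scales_parabolic; rewrite invr_gt0.
rewrite -ge0_integralZlT//.
apply: eq_integral => m _; rewrite /patch.
have [Dm|Dm] := pselect (D (parabolic L m)); last first.
  by rewrite !memNset// mule0.
rewrite !mem_set// -EFinM; congr EFin.
have sm : swirl_point U u (parabolic L m) by exact: sD.
have rm : 0 < rcoord m.
  have [_ + _] := sm; rewrite /rcoord/= pmulr_lgt0// invr_gt0//.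
rewrite (current_velocity_rescale _ _ _ _ _ _ NS sm) rho_rescale// sqnormZ.
by rewrite /K; ring.
Qed.

End ActionScaling.

(** * The strained vortex *)

Section SmoothClass.
Context {R : realType} {V : normedModType R}.

(** The induction on the order must range over the whole class, since each step replaces [f] by a
    directional derivative. *)
Lemma smooth_on_class (P : (V -> R) -> Prop) (U : set V) :
  (forall f, P f -> (forall a, differentiable f a) /\ forall v, P ('D_v f)) ->
  forall f, P f -> smooth_on U f.
Proof.
move=> HP f Pf n; elim: n f Pf => [|n IH] f Pf /=; have [df Pdf] := HP _ Pf.
  by move=> a _; exact: differentiable_continuous.
by split=> [a _|v]; [exact: df|exact: IH].
Qed.

End SmoothClass.

Section Strain.
Context {R : realType}.
Local Notation R4 := (R * R * R * R)%type.
Implicit Types (a v : R4).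

Definition cX a : R := a.1.1.1.
Definition cY a : R := a.1.1.2.
Definition cZ a : R := a.1.2.
Definition cE a : R := expR a.2.

(** Polynomials in x, y, z and e^t: an algebra stable under differentiation that contains the
    strained vortex and its pressure. *)
Inductive exp_polynomial : (R4 -> R) -> Prop :=
| EPcst c : exp_polynomial (fun=> c)
| EPX : exp_polynomial cX
| EPY : exp_polynomial cY
| EPZ : exp_polynomial cZ
| EPE : exp_polynomial cE
| EPD f g : exp_polynomial f -> exp_polynomial g ->
    exp_polynomial (fun a => f a + g a)
| EPM f g : exp_polynomial f -> exp_polynomial g ->
    exp_polynomial (fun a => f a * g a).

Lemma is_derive_cX a v : is_derive a v cX v.1.1.1.
Proof.
apply/is_derive_lineP; rewrite /cX/=; apply: is_derive_eq.
by rewrite /GRing.scale/=; ring.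
Qed.

Lemma is_derive_cY a v : is_derive a v cY v.1.1.2.
Proof.
apply/is_derive_lineP; rewrite /cY/=; apply: is_derive_eq.
by rewrite /GRing.scale/=; ring.
Qed.

Lemma is_derive_cZ a v : is_derive a v cZ v.1.2.
Proof.
apply/is_derive_lineP; rewrite /cZ/=; apply: is_derive_eq.
by rewrite /GRing.scale/=; ring.
Qed.

Lemma is_derive_cE a v : is_derive a v cE (cE a * v.2).
Proof.
apply: (is_derive_chain expR (fun a => a.2) a v _ _ (is_derive_expR _)).
apply/is_derive_lineP; rewrite /=; apply: is_derive_eq.
by rewrite /GRing.scale/=; ring.
Qed.

Lemma differentiable_fst (V W : normedModType R) (x : V * W) :
  differentiable fst x.
Proof.
apply: linear_differentiable => y; exact: cvg_fst.
Qed.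

Lemma differentiable_snd (V W : normedModType R) (x : V * W) :
  differentiable snd x.
Proof.
apply: linear_differentiable => y; exact: cvg_snd.
Qed.

Lemma exp_polynomial_closed f : exp_polynomial f ->
  (forall a, differentiable f a) /\ forall v, exp_polynomial ('D_v f).
Proof.
elim=> {f} [c||||| f g Pf [df Df] Pg [dg Dg] | f g Pf [df Df] Pg [dg Dg]].
- split=> [a|v]; first exact: differentiable_cst.
  rewrite (_ : 'D_v _ = fun=> 0); first exact: EPcst.
  by apply/funext => a; rewrite derive_cst.
- split=> [a|v].
    apply: (@differentiable_comp _ _ _ _ (fun a : R4 => a.1.1) fst);
      last exact: differentiable_fst.
    by apply: (@differentiable_comp _ _ _ _ (fst : R4 -> _) fst);
      exact: differentiable_fst.
  rewrite (_ : 'D_v _ = fun=> v.1.1.1); first exact: EPcst.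
  by apply/funext => a; apply: derive_val; exact: is_derive_cX.
- split=> [a|v].
    apply: (@differentiable_comp _ _ _ _ (fun a : R4 => a.1.1) snd);
      last exact: differentiable_snd.
    by apply: (@differentiable_comp _ _ _ _ (fst : R4 -> _) fst);
      exact: differentiable_fst.
  rewrite (_ : 'D_v _ = fun=> v.1.1.2); first exact: EPcst.
  by apply/funext => a; apply: derive_val; exact: is_derive_cY.
- split=> [a|v].
    by apply: (@differentiable_comp _ _ _ _ (fst : R4 -> _) snd);
      [exact: differentiable_fst|exact: differentiable_snd].
  rewrite (_ : 'D_v _ = fun=> v.1.2); first exact: EPcst.
  by apply/funext => a; apply: derive_val; exact: is_derive_cZ.
- split=> [a|v].
    apply: (@differentiable_comp _ _ _ _ (snd : R4 -> _) expR).
      exact: differentiable_snd.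
    by apply/derivable1_diffP.
  rewrite (_ : 'D_v _ = fun a => cE a * v.2).
    by apply: EPM; [exact: EPE|exact: EPcst].
  by apply/funext => a; apply: derive_val; exact: is_derive_cE.
- split=> [a|v]; first exact: differentiableD.
  rewrite (_ : 'D_v _ = fun a => 'D_v f a + 'D_v g a); first exact: EPD.
  by apply/funext => a; rewrite -deriveD//; exact: diff_derivable.
- split=> [a|v]; first exact: differentiableM.
  rewrite (_ : 'D_v _ = fun a => f a * 'D_v g a + g a * 'D_v f a).
    by apply: EPD; exact: EPM.
  by apply/funext => a; rewrite -[RHS]deriveM//; exact: diff_derivable.
Qed.

Lemma exp_polynomial_smooth (U : set R4) f : exp_polynomial f -> smooth_on U f.
Proof. exact: smooth_on_class exp_polynomial_closed f. Qed.

End Strain.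

(** * The strained vortex as an exact solution *)

Section StrainFlow.
Context {R : realType}.
Local Notation R4 := (R * R * R * R)%type.
Implicit Types (a v : R4).

(** One shape for both horizontal components, a steady linear part plus e^t times a linear part, so
    that derivatives are computed once. *)
Definition planar (al be ga de : R) a : R :=
  (al * cX a + be * cY a) + cE a * (ga * cX a + de * cY a).

(** The time derivative of the rotation cancels its coupling with the strain, leaving the
    acceleration (1/4 - e^(2t)) (x, y) horizontally and z vertically; the pressure is minus its
    potential. Signs are written as constant factors to fit the constructors of [exp_polynomial]. *)
Definition strain_pressure a : R :=
  (- 2^-1) * ((4^-1 + (- 1) * (cE a * cE a)) * (cX a * cX a + cY a * cY a)
     + cZ a * cZ a).

(* Uniform strain plus a rigid rotation whose rate e^t is amplified by the
   vortex stretching: u^r = - r / 2, u^theta = e^t r, u^z = z. *)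
Definition strain_flow : flow R :=
  Flow (planar (- 2^-1) 0 0 (- 1)) (planar 0 (- 2^-1) 1 0) cZ strain_pressure.

Lemma exp_polynomial_planar al be ga de : exp_polynomial (planar al be ga de).
Proof. by repeat (apply: EPD || apply: EPM || constructor). Qed.

Lemma exp_polynomial_pressure : exp_polynomial strain_pressure.
Proof. by repeat (apply: EPD || apply: EPM || constructor). Qed.

Lemma derive_planar al be ga de v : 'D_v (planar al be ga de) =
  fun a => (al * v.1.1.1 + be * v.1.1.2)
    + (cE a * (ga * v.1.1.1 + de * v.1.1.2)
       + v.2 * cE a * (ga * cX a + de * cY a)).
Proof.
apply/funext => a.
have dX := is_derive_cX a v; have dY := is_derive_cY a v.
have dE := is_derive_cE a v.
apply: derive_val.
have h := is_deriveD (is_deriveD (is_deriveZ al dX) (is_deriveZ be dY))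
  (is_deriveM dE (is_deriveD (is_deriveZ ga dX) (is_deriveZ de dY))).
apply: is_derive_eq h _.
rewrite (_ : (ga *: cX + de *: cY) a = ga * cX a + de * cY a)//.
by rewrite /GRing.scale/=; ring.
Qed.

Lemma derive_cZ v : 'D_v (@cZ R) = fun=> v.1.2.
Proof. by apply/funext => a; apply: derive_val; exact: is_derive_cZ. Qed.

Lemma derive_strain_pressure v : 'D_v strain_pressure = fun a =>
  (- 4^-1 + cE a ^+ 2) * (cX a * v.1.1.1 + cY a * v.1.1.2)
    + cE a ^+ 2 * v.2 * (cX a ^+ 2 + cY a ^+ 2) - cZ a * v.1.2.
Proof.
apply/funext => a.
have dX := is_derive_cX a v; have dY := is_derive_cY a v.
have dE := is_derive_cE a v; have dZ := is_derive_cZ a v.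
apply: derive_val.
have h := is_deriveZ (- 2^-1) (is_deriveD (is_deriveM
  (is_deriveD (is_derive_cst (4^-1 : R) a v)
    (is_deriveZ (- 1) (is_deriveM dE dE)))
  (is_deriveD (is_deriveM dX dX) (is_deriveM dY dY))) (is_deriveM dZ dZ)).
apply: is_derive_eq h _.
rewrite (_ : (cst 4^-1 + -1 *: (cE * cE)) a = 4^-1 + (- 1) * (cE a * cE a))//.
rewrite (_ : (cX * cX + cY * cY) a = cX a * cX a + cY a * cY a)//.
by rewrite /GRing.scale/=; field.
Qed.

Lemma Dx_planar al be ga de :
  Dx (planar al be ga de) = fun a => al + cE a * ga.
Proof.
rewrite [LHS](derive_planar al be ga de (1, 0, 0, 0)).
by apply/funext => a /=; ring.
Qed.

Lemma Dy_planar al be ga de :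
  Dy (planar al be ga de) = fun a => be + cE a * de.
Proof.
rewrite [LHS](derive_planar al be ga de (0, 1, 0, 0)).
by apply/funext => a /=; ring.
Qed.

Lemma Dz_planar al be ga de : Dz (planar al be ga de) = fun=> 0.
Proof.
rewrite [LHS](derive_planar al be ga de (0, 0, 1, 0)).
by apply/funext => a /=; ring.
Qed.

Lemma Dt_planar al be ga de :
  Dt (planar al be ga de) = fun a => cE a * (ga * cX a + de * cY a).
Proof.
rewrite [LHS](derive_planar al be ga de (0, 0, 0, 1)).
by apply/funext => a /=; ring.
Qed.

Lemma derive_affine_cE al ga v a :
  'D_v (fun a => al + cE a * ga) a = cE a * v.2 * ga.
Proof.
have dE := is_derive_cE a v; apply: derive_val; apply: is_derive_eq.
by rewrite /GRing.scale/=; ring.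
Qed.

Lemma laplacian_planar al be ga de a : laplacian (planar al be ga de) a = 0.
Proof.
rewrite /laplacian Dx_planar Dy_planar Dz_planar.
rewrite /Dx /Dy /Dz !derive_affine_cE derive_cst /=; ring.
Qed.

Lemma Dx_cZ : Dx (@cZ R) = fun=> 0. Proof. exact: derive_cZ. Qed.
Lemma Dy_cZ : Dy (@cZ R) = fun=> 0. Proof. exact: derive_cZ. Qed.
Lemma Dz_cZ : Dz (@cZ R) = fun=> 1. Proof. exact: derive_cZ. Qed.
Lemma Dt_cZ : Dt (@cZ R) = fun=> 0. Proof. exact: derive_cZ. Qed.

Lemma laplacian_cZ a : laplacian cZ a = 0.
Proof.
rewrite /laplacian Dx_cZ Dy_cZ Dz_cZ.
by rewrite /Dx /Dy /Dz !derive_cst !addr0.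
Qed.

Lemma Dx_pressure : Dx strain_pressure = fun a => (- 4^-1 + cE a ^+ 2) * cX a.
Proof.
rewrite [LHS](derive_strain_pressure (1, 0, 0, 0)).
by apply/funext => a /=; ring.
Qed.

Lemma Dy_pressure : Dy strain_pressure = fun a => (- 4^-1 + cE a ^+ 2) * cY a.
Proof.
rewrite [LHS](derive_strain_pressure (0, 1, 0, 0)).
by apply/funext => a /=; ring.
Qed.

Lemma Dz_pressure : Dz strain_pressure = fun a => - cZ a.
Proof.
rewrite [LHS](derive_strain_pressure (0, 0, 1, 0)).
by apply/funext => a /=; ring.
Qed.

Lemma strain_flow_NS (nu : R) : axisymmetric_NS nu setT strain_flow.
Proof.
split.
  split; first exact: openT.
  - split; apply: exp_polynomial_smooth; [exact: exp_polynomial_planar..| |].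
      exact: EPZ.
    exact: exp_polynomial_pressure.
  - move=> a _ /=; rewrite Dx_planar Dy_planar Dz_cZ.
    by field.
  - move=> a _ /=; rewrite /advect /= !laplacian_planar laplacian_cZ.
    rewrite !Dx_planar !Dy_planar !Dz_planar !Dt_planar Dx_cZ Dy_cZ Dz_cZ Dt_cZ.
    rewrite Dx_pressure Dy_pressure Dz_pressure /planar.
    by split; field.
move=> th [[[x y] z] t] _ /=.
have cs : cos th ^+ 2 + sin th ^+ 2 = 1 by exact: cos2Dsin2.
rewrite /planar /strain_pressure /cX /cY /cZ /cE /=.
have rot : (cos th * x - sin th * y) * (cos th * x - sin th * y)
    + (sin th * x + cos th * y) * (sin th * x + cos th * y) = x * x + y * y.
  by rewrite -[RHS]mul1r -cs; ring.
by split=> //; [ring|ring|rewrite rot].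
Qed.

End StrainFlow.

(** * Bounds on the action of the strained vortex *)

Section StrainAction.
Context {R : realType}.
Implicit Types (m v : R * R * R).
Local Notation mu3 :=
  ((@lebesgue_measure R \x @lebesgue_measure R) \x @lebesgue_measure R)%E.

(** The box stays off the axis and has measure 1, so bounds on the integrand are bounds on the
    action. *)
Definition strain_box : set (R * R * R) :=
  (`[1, 2]%classic `*` `[0, 1]%classic) `*` `[0, 1]%classic.

Lemma strain_boxP m : strain_box m ->
  [/\ 1 <= m.1.1 <= 2, 0 <= m.1.2 <= 1 & 0 <= m.2 <= 1].
Proof. by move=> [[/=]]; rewrite !in_itv/=. Qed.

Lemma measurable_strain_box : measurable strain_box.
Proof. by apply: measurableX => //; exact: measurableX. Qed.

Lemma measure_strain_box : mu3 strain_box = 1%E.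
Proof.
have I01 : lebesgue_measure (`[0, 1] : set R)%classic = 1%E.
  by rewrite lebesgue_measure_itv/= lte_fin ltr01 oppr0 adde0.
have I12 : lebesgue_measure (`[1, 2] : set R)%classic = 1%E.
  by rewrite lebesgue_measure_itv/= lte_fin ltr1n -EFinD; congr EFin; ring.
have mI (a b : R) : measurable (`[a, b] : set R)%classic by [].
have E2 := @product_measure1E _ _ _ _ R (@lebesgue_measure R)
  (@lebesgue_measure R) _ _ (mI 1 2) (mI 0 1).
have E3 := @product_measure1E _ _ _ _ R
  (@lebesgue_measure R \x @lebesgue_measure R)%E (@lebesgue_measure R)
  _ _ (measurableX (mI 1 2) (mI 0 1)) (mI 0 1).
rewrite [LHS]E3 [X in (_ * X)%E]I01 mule1 [LHS]E2.
by rewrite [X in (X * _)%E]I12 [X in (_ * X)%E]I01 mule1.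
Qed.

Lemma Gamma_strain m : Gamma strain_flow m = expR m.2 * m.1.1 ^+ 2.
Proof.
rewrite /Gamma /utheta /rcoord/= /planar /cX /cY /cE /=; ring.
Qed.

Lemma strain_box_swirl : swirl_region setT strain_flow strain_box.
Proof.
split; first exact: measurable_strain_box.
move=> m /strain_boxP[/andP[r1 _] _ _]; have r0 : 0 < m.1.1 by lra.
by split => //; rewrite Gamma_strain mulf_neq0 ?gt_eqF ?expR_gt0 ?exprn_gt0.
Qed.

Lemma phi_strain m : 0 < rcoord m ->
  phi strain_flow m = m.2 + 2 * ln (rcoord m).
Proof.
move=> r0; rewrite /phi Gamma_strain -/(rcoord m).
rewrite ger0_norm; last by rewrite mulr_ge0 ?expR_ge0 ?sqr_ge0.
by rewrite lnM ?posrE ?expR_gt0 ?exprn_gt0// expRK lnXn// mulr_natl.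
Qed.

Lemma current_velocity_strain (nu p : R) m : 0 < rcoord m ->
  current_velocity nu p strain_flow m
  = (- (rcoord m / 2 + 2 * (p * nu) / rcoord m), m.1.2).
Proof.
move=> r0; have rn0 : rcoord m != 0 by rewrite gt_eqF.
(* The viscosity 1 is arbitrary: the flow solves the equations for each value, and [nu] is here only
   a parameter of the current. *)
have NS := strain_flow_NS (R := R) 1.
have sm : swirl_point setT strain_flow m.
  by split => //; rewrite Gamma_strain mulf_neq0 ?gt_eqF ?expR_gt0 ?exprn_gt0.
have E0 : expR m.2 != 0 by rewrite gt_eqF ?expR_gt0.
have dr : d_r (phi strain_flow) m = 2 / rcoord m.
  rewrite [LHS](@derive_val _ _ _ _ _ _ _
    (is_derive_phi _ _ _ _ (1, 0, 0) NS sm)).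
  rewrite -[X in _ + _ * X]/(Dx (planar 0 (- 2^-1) 1 0) (lift0 m))
    Dx_planar Gamma_strain.
  rewrite -/(rcoord m) /= /planar /cX /cY /cE /= -/(rcoord m).
  by field; rewrite ?rn0 ?E0.
have dz : d_z (phi strain_flow) m = 0.
  rewrite [LHS](@derive_val _ _ _ _ _ _ _
    (is_derive_phi _ _ _ _ (0, 1, 0) NS sm)).
  rewrite -[X in _ + _ * X]/(Dz (planar 0 (- 2^-1) 1 0) (lift0 m))
    Dz_planar.
  by rewrite !mul0r mulr0 addr0 mul0r.
rewrite /current_velocity /grad dr dz /drift /ur /uzm /=.
rewrite /planar /cX /cY /cZ /cE /= -/(rcoord m).
congr (_, _); rewrite /= /GRing.scale/=; last by ring.
by field.
Qed.

(** The exponent is p (t + 2 ln r) - k ln r. On the box 0 <= ln r <= r - 1 <= 1 and 0 <= t <= 1,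
    whence 3 p and |k|. *)
Lemma rho_strain_bounds (p k : R) m : 0 < p -> strain_box m ->
  expR (- (3 * p + `|k|)) <= rho p k strain_flow m <= expR (3 * p + `|k|).
Proof.
move=> p0 Bm; have [/andP[r1 r2] _ /andP[t0 t1]] := strain_boxP _ Bm.
have [_ sB] := strain_box_swirl; have sm := sB _ Bm.
have r0 : 0 < rcoord m by case: sm.
rewrite (rhoE _ _ _ _ _ sm) phi_strain// !ler_expR.
have l0 : 0 <= ln (rcoord m) by rewrite ln_ge0.
have l1 : ln (rcoord m) <= 1.
  have := @le_ln1Dx R (rcoord m - 1).
  rewrite (_ : 1 + (rcoord m - 1) = rcoord m); last by ring.
  move=> h; apply: (le_trans (h _)); rewrite /rcoord; lra.
set l := ln _ in l0 l1 *; set t := m.2 in t0 t1 *.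
have kl : `|k * l| <= `|k| by rewrite normrM ler_piMr// ger0_norm.
have := kl; rewrite ler_norml => /andP[kl1 kl2].
have h0 : 0 <= p * (t + 2 * l) by rewrite mulr_ge0; lra.
have h1 : p * (t + 2 * l) <= p * 3 by rewrite ler_wpM2l//; lra.
by apply/andP; split; lra.
Qed.

(** The radial component has modulus r / 2 + 2 p nu / r, a sum of positive terms between 1/2 and 1 +
    2 p nu; the axial one is z, with z^2 <= 1. *)
Lemma sqnorm_strain_bounds (nu p : R) m : 0 < nu -> 0 < p -> strain_box m ->
  4^-1 <= sqnorm (current_velocity nu p strain_flow m)
       <= (1 + 2 * (p * nu)) ^+ 2 + 1.
Proof.
move=> nu0 p0 Bm.
have [/andP[r1 r2] /andP[z0 z1] _] := strain_boxP _ Bm.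
have r0 : 0 < rcoord m by rewrite /rcoord; lra.
rewrite current_velocity_strain// /sqnorm/= sqrrN.
have c0 : 0 < p * nu by rewrite mulr_gt0.
set r := rcoord m in r0 *; set c := p * nu in c0 *.
have q0 : 0 <= 2 * c / r by rewrite divr_ge0; lra.
have q1 : 2 * c / r <= 2 * c.
  by rewrite ler_pdivrMr// ler_peMr; rewrite /r /rcoord; lra.
set q := 2 * c / r in q0 q1 *.
have rr : 1 <= r <= 2 by rewrite r1 r2.
move: rr => /andP[rr1 rr2].
apply/andP; split.
  have h : 4^-1 <= (r / 2 + q) ^+ 2.
    rewrite (_ : 4^-1 = (2^-1 : R) ^+ 2); last by field.
    by rewrite ler_sqr ?nnegrE; lra.
  by have := sqr_ge0 m.1.2; lra.
apply: lerD; first by rewrite ler_sqr ?nnegrE; lra.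
by rewrite expr_le1.
Qed.

Lemma action_strain_gt0 (nu p k : R) : 0 < nu -> 0 < p ->
  exists2 x : R, 0 < x & action nu p k strain_flow strain_box = x%:E.
Proof.
move=> nu0 p0.
pose lo := expR (- (3 * p + `|k|)) / 4.
pose hi := expR (3 * p + `|k|) * ((1 + 2 * (p * nu)) ^+ 2 + 1).
have lo0 : 0 < lo by rewrite divr_gt0 ?expR_gt0.
pose F m := rho p k strain_flow m *
  sqnorm (current_velocity nu p strain_flow m).
have FB m : strain_box m -> lo <= F m <= hi.
  move=> Bm; have /andP[a1 a2] := rho_strain_bounds p k m p0 Bm.
  have /andP[b1 b2] := sqnorm_strain_bounds nu p m nu0 p0 Bm.
  by rewrite /lo /hi !ler_pM ?expR_ge0 ?invr_ge0 ?rho_ge0 ?sqnorm_ge0.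
have cB (x : R) : (\int[mu3]_(m in strain_box) x%:E = x%:E)%E.
  rewrite integral_cst; last exact: measurable_strain_box.
  by rewrite [X in (_ * X)%E]measure_strain_box mule1.
have h1 : (lo%:E <= action nu p k strain_flow strain_box)%E.
  rewrite -(cB lo) /action integral_mkcond [leRHS]integral_mkcond.
  apply: ge0_le_integralT => m; rewrite /patch; case: ifPn => //.
    by move=> _; rewrite lee_fin ltW.
  by rewrite inE => /FB/andP[]; rewrite lee_fin.
have h2 : (action nu p k strain_flow strain_box <= hi%:E)%E.
  rewrite -(cB hi) /action integral_mkcond [leRHS]integral_mkcond.
  apply: ge0_le_integralT => m; rewrite /patch; case: ifPn => //.
    by move=> _; rewrite lee_fin mulr_ge0 ?rho_ge0 ?sqnorm_ge0.
  by rewrite inE => /FB/andP[]; rewrite lee_fin.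
have fa : action nu p k strain_flow strain_box \is a fin_num.
  rewrite ge0_fin_numE; first exact: le_lt_trans h2 (ltry _).
  by apply: le_trans h1; rewrite lee_fin ltW.
exists (fine (action nu p k strain_flow strain_box)); last by rewrite fineK.
by rewrite -lte_fin fineK//; apply: lt_le_trans h1; rewrite lte_fin.
Qed.

End StrainAction.

Theorem proposition11p3 (R : realType) (nu p k : R) (nu_gt0 : 0 < nu)
    (p_gt0 : 0 < p) :
  [/\ (forall (U : set (R * R * R * R)) (u : flow R) (D : set (R * R * R)),
         axisymmetric_NS nu U u -> swirl_region U u D ->
         forall m, D m ->
         d_t (rho p k u) m
           + flat_div (fun m' => rho p k u m' *: current_velocity nu p u m') m
         = rho p k u m *
             ((k + 1) * compression u m
              + p * nu * ((k - 1) * (d_r (phi u) m / rcoord m)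
                          - (p - 1) * sqnorm (grad (phi u) m)))),
      has_scale_weight nu (action nu p k) (2 - k),
      (forall (U : set (R * R * R * R)) (u : flow R) (D : set (R * R * R)),
         axisymmetric_NS nu U u -> swirl_region U u D ->
         forall m, D m -> (k + 1) * compression u m = 0) <-> k = -1
    & scale_invariant nu (action nu p k) <-> k = 2].
Proof.
split.
- move=> U u D NS [_ sD] m Dm; apply: continuity_equation NS _; exact: sD.
- exact: action_scale_weight.
- split=> [H|-> U u D _ _ m _]; last by rewrite addrC subrr mul0r.
  (* At this point the compression is 1/2, so the hypothesis reads (k + 1) / 2 = 0. *)
  have B : @strain_box R (1, 0, 0).
    by split; [split|] => /=; rewrite in_itv/= ?lexx ?ler01 ?ler1n.
  have := H _ _ _ (strain_flow_NS nu) strain_box_swirl _ B.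
  rewrite /compression /ur /rcoord /= /planar /cX /cY /cE /= => e.
  have {}e : (k + 1) * 2^-1 = 0 by rewrite -[RHS]e; field.
  by lra.
- have W := action_scale_weight (R := R) nu p k.
  split=> [H|k2]; last first.
    by move: W; rewrite /scale_invariant k2 subrr.
  have [x x0 ax] := action_strain_gt0 nu p k nu_gt0 p_gt0.
  have NS := strain_flow_NS nu.
  (* Comparing the weights 0 and 2 - k at length L = 2 gives x = 2^(2 - k) x. Cancelling the finite
     positive x and taking logarithms leaves 2 - k = 0. *)
  have := W 2 _ _ _ (ltr0n _ 2) NS strain_box_swirl.
  rewrite (H 2 _ _ _ (ltr0n _ 2) NS strain_box_swirl) ax powRr0 -!EFinM.
  move=> [] /(mulIf (lt0r_neq0 x0)) e.
  have : ln (2 `^ (2 - k)) = 0 :> R by rewrite -e ln1.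
  have l2 : 0 < ln (2 : R) by rewrite ln_gt0// ltr1n.
  rewrite ln_powR => /eqP; rewrite mulf_eq0 (gt_eqF l2) orbF => /eqP.
  by lra.
Qed.
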